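(* Let $d=d_1\cdots d_n$ with $d_r=p_r^{k_r}$, $p_r$ prime and $k_r\in\mathbb{N}$, $k_r\ge 1$, for $r=1,\ldots,n$, such that $d_1\le\cdots\le d_n$. Suppose given a set of $d_1+1$ pairwise mutually unbiased product bases of $\mathbb{C}^d=\mathbb{C}^{d_1}\otimes\cdots\otimes\mathbb{C}^{d_n}$, such that each of these product bases contains at least one orthogonal set of $d_1$ vectors in the subsystem $\mathbb{C}^{d_1}$ (that is, among the first tensor factors of its $d$ basis vectors there are $d_1$ mutually orthogonal ones). Then any unit vector $|\mu\rangle\in\mathbb{C}^d$ which is mutually unbiased to all of these $d_1+1$ bases is maximally entangled across $\mathbb{C}^{d_1}\otimes\mathbb{C}^{d_{\overline{1}}}$, where $d_{\overline{1}}=d/d_1$ and $\mathbb{C}^{d_{\overline{1}}}=\mathbb{C}^{d_2}\otimes\cdots\otimes\mathbb{C}^{d_n}$.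
   Context: A product basis of $\mathbb{C}^{d_1}\otimes\cdots\otimes\mathbb{C}^{d_n}$ is an orthonormal basis each of whose vectors is a tensor product $|\psi^1\rangle\otimes\cdots\otimes|\psi^n\rangle$ with $|\psi^r\rangle\in\mathbb{C}^{d_r}$. It need not be a tensor product of bases of the factors. Two orthonormal bases $\{|a_i\rangle\}$, $\{|b_j\rangle\}$ of $\mathbb{C}^d$ are mutually unbiased if $|\langle a_i|b_j\rangle|^2=1/d$ for all $i,j$. A unit vector $|\mu\rangle$ is mutually unbiased to a basis $\{|a_i\rangle\}$ of $\mathbb{C}^d$ if $|\langle a_i|\mu\rangle|^2=1/d$ for all $i$. A unit vector $|\mu\rangle$ is maximally entangled across $\mathbb{C}^{d_1}\otimes\mathbb{C}^{d_{\overline{1}}}$ if its reduced density matrix on $\mathbb{C}^{d_1}$ is maximally mixed: $\rho_1=\mathrm{tr}_{\overline{1}}|\mu\rangle\langle\mu|=\frac{1}{d_1}\mathbb{1}$, where $\mathrm{tr}_{\overline{1}}$ is the partial trace over $\mathbb{C}^{d_{\overline{1}}}$. *)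

(* Defs.v *)
From HB Require Import structures.
From mathcomp Require Import all_boot all_order all_algebra.
From mathcomp Require Import complex.
From mathcomp Require Import reals.

Set Implicit Arguments.
Unset Strict Implicit.
Unset Printing Implicit Defensive.

Import Order.TTheory GRing.Theory Num.Theory.
Local Open Scope ring_scope.

(* The Hilbert space with computational basis indexed by I; C^m is ket C 'I_m. *)
Definition ket (C : numClosedFieldType) (I : finType) : Type := {ffun I -> C}.

(* Conjugate-linear in the first argument. *)
Definition braket (C : numClosedFieldType) (I : finType) (u v : ket C I) : C :=
  \sum_x (u x)^* * v x.

Definition unit_ket (C : numClosedFieldType) (I : finType) (u : ket C I) : Prop :=
  braket u u = 1.

Definition orthonormal_basis (C : numClosedFieldType) (I J : finType)
    (b : J -> ket C I) : Prop :=
  (forall i j, braket (b i) (b j) = (i == j)%:R) /\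
  (forall v : ket C I, exists c : J -> C, forall x, v x = \sum_j c j * b j x).

Definition unbiased_bases (C : numClosedFieldType) (I J : finType)
    (a b : J -> ket C I) : Prop :=
  forall i j, `|braket (a i) (b j)| ^+ 2 = #|I|%:R^-1.

Definition unbiased_to_basis (C : numClosedFieldType) (I J : finType)
    (u : ket C I) (a : J -> ket C I) : Prop :=
  forall i, `|braket (a i) u| ^+ 2 = #|I|%:R^-1.

(* C^(d 0) (x) ... (x) C^(d n) is ket C (multi_index d): its computational basis
   consists of the |x_0> (x) ... (x) |x_n>. *)
Definition multi_index (n : nat) (d : 'I_n.+1 -> nat) : finType :=
  {dffun forall r : 'I_n.+1, 'I_(d r)}.

Definition tensor (C : numClosedFieldType) (n : nat) (d : 'I_n.+1 -> nat)
    (psi : forall r, ket C 'I_(d r)) : ket C (multi_index d) :=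
  [ffun x : multi_index d => \prod_r psi r (x r)].

Definition product_basis (C : numClosedFieldType) (n : nat) (d : 'I_n.+1 -> nat)
    (J : finType) (b : J -> ket C (multi_index d)) : Prop :=
  orthonormal_basis b /\
  (forall i, exists psi : forall r, ket C 'I_(d r), b i = tensor psi).

(* The tensor factors of a nonzero product vector are unique up to nonzero
   scalars, so the choice of psi does not affect orthogonality of factors; the
   factors being nonzero, mutually orthogonal ones are also distinct. *)
Definition has_orthogonal_factors (C : numClosedFieldType) (n : nat)
    (d : 'I_n.+1 -> nat) (J : finType) (r : 'I_n.+1)
    (b : J -> ket C (multi_index d)) : Prop :=
  exists (psi : J -> forall s, ket C 'I_(d s)) (f : 'I_(d r) -> J),
    (forall i, b i = tensor (psi i)) /\
    (forall i j, i != j -> braket (psi (f i) r) (psi (f j) r) = 0).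

Definition ketbra (C : numClosedFieldType) (I : finType) (u : ket C I)
    (x y : I) : C :=
  u x * (u y)^*.

(* The partial trace over all factors other than r of the operator with matrix
   entries rho x y: the (a, b) entry sums rho x y over the x, y with r-th
   components a, b that agree in every other component. *)
Definition partial_trace_but (C : numClosedFieldType) (n : nat)
    (d : 'I_n.+1 -> nat) (r : 'I_n.+1)
    (rho : multi_index d -> multi_index d -> C) : 'M[C]_(d r) :=
  \matrix_(a, b) \sum_(x : multi_index d | x r == a)
    \sum_(y : multi_index d |
            (y r == b) && [forall s, (s != r) ==> (y s == x s)]) rho x y.

Definition maximally_entangled (C : numClosedFieldType) (n : nat)
    (d : 'I_n.+1 -> nat) (r : 'I_n.+1) (u : ket C (multi_index d)) : Prop :=
  unit_ket u /\ partial_trace_but r (ketbra u) = ((d r)%:R^-1)%:M.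

(* Main.v *)
(* Reduce to the cut C^n (x) C^m with n = d_1.  For a product vector u (x) w
   unbiased to a product basis phi_j (x) alpha_j, the numbers |<phi_j|u>|^2 and
   |<alpha_j|w>|^2 have averages 1/n and 1/m and products 1/(nm), so by the
   equality case of AM-GM they are constant: first factors of different bases
   are unbiased.  The n orthogonal first factors of the n + 1 bases thus form a
   complete set of mutually unbiased bases of C^n, which is a 2-design: summing
   <v|X|v> |v><v| over all its vectors gives X + tr X for every operator X.
   With X = |phi><phi| for phi another first factor of the s-th basis, this
   shows that phi is proportional to a vector of the s-th basis of the design.
   Hence |v><v| (x) 1 acts on each phi_j (x) alpha_j as 0 or 1, and expanding mu
   in the s-th basis gives <v|rho_1|v> = 1/n.  Finally X = rho_1 yields
   rho_1 = 1/n. *)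

Require Import Defs.
From HB Require Import structures.
From mathcomp Require Import all_boot all_order all_algebra.
From mathcomp Require Import complex.
From mathcomp Require Import reals.
From mathcomp Require Import ring.

Set Implicit Arguments.
Unset Strict Implicit.
Unset Printing Implicit Defensive.

Import Order.TTheory GRing.Theory Num.Theory.
Local Open Scope ring_scope.

(** * Inner products and completeness of orthonormal bases *)

Lemma braketC (C : numClosedFieldType) (I : finType) (u v : ket C I) :
  braket v u = (braket u v)^*.
Proof.
rewrite /braket rmorph_sum; apply: eq_bigr => x _.
by rewrite rmorphM /= conjCK mulrC.
Qed.

Lemma sum_deltar (C : pzRingType) (I : finType) (F : I -> C) (a : I) :
  \sum_b F b * (a == b)%:R = F a.
Proof.
rewrite (bigD1 a) //= eqxx mulr1 big1 ?addr0 // => b.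
by rewrite eq_sym => /negPf ->; rewrite mulr0.
Qed.

(** By orthonormality, the computational basis vector at [y] has the conjugates of the [b j y] as
    its coefficients in [b]; the relation is the [x]-th entry of this expansion. *)
Lemma orthonormal_basis_complete (C : numClosedFieldType) (I J : finType)
    (b : J -> ket C I) : orthonormal_basis b ->
  forall x y, \sum_j b j x * (b j y)^* = (x == y)%:R.
Proof.
move=> [orth span] x y.
have [c Ec] := span [ffun z => (z == y)%:R].
have := Ec x; rewrite ffunE => ->; apply: eq_bigr => j _; rewrite mulrC.
congr (_ * _).
have -> : (b j y)^* = braket (b j) [ffun z => (z == y)%:R].
  rewrite /braket -[LHS](sum_deltar (fun z => (b j z)^*)).
  by apply: eq_bigr => z _; rewrite ffunE eq_sym.
rewrite /braket.
under eq_bigr => z _ do rewrite Ec mulr_sumr.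
rewrite exchange_big /= -[RHS](sum_deltar c).
apply: eq_bigr => l _; rewrite -orth /braket mulr_sumr.
by apply: eq_bigr => z _; rewrite mulrCA.
Qed.

(** Double counting: the squared moduli of all entries [b j x] sum to [#|J|] by normalization and to
    [#|I|] by completeness. *)
Lemma orthonormal_basis_card (C : numClosedFieldType) (I J : finType)
    (b : J -> ket C I) : orthonormal_basis b -> #|J| = #|I|.
Proof.
move=> ob; have [orth _] := ob; apply/eqP; rewrite -(eqr_nat C); apply/eqP.
transitivity (\sum_(j : J) braket (b j) (b j)).
  by under eq_bigr => j _ do rewrite orth eqxx; rewrite sumr_const.
rewrite /braket exchange_big /=.
transitivity (\sum_(x : I) (1 : C)); last by rewrite sumr_const.
apply: eq_bigr => x _; have := orthonormal_basis_complete ob x x.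
by rewrite eqxx /= mulr1n => <-; apply: eq_bigr => j _; rewrite mulrC.
Qed.

(** * Projective 2-designs from the frame potential *)

Lemma sum4_prod (C : comPzRingType) (I : finType) (f g h q : I -> C) :
  \sum_(p : I * I * I * I) f p.1.1.1 * g p.1.1.2 * h p.1.2 * q p.2
    = (\sum_a f a) * (\sum_a g a) * (\sum_a h a) * (\sum_a q a).
Proof.
rewrite -(pair_bigA _ (fun r e => f r.1.1 * g r.1.2 * h r.2 * q e)) /=.
under eq_bigr => r _ do rewrite -mulr_sumr.
rewrite -mulr_suml; congr (_ * _).
rewrite -(pair_bigA _ (fun r e => f r.1 * g r.2 * h e)) /=.
under eq_bigr => r _ do rewrite -mulr_sumr.
rewrite -mulr_suml; congr (_ * _).
rewrite -(pair_bigA _ (fun r e => f r * g e)) /=.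
under eq_bigr => r _ do rewrite -mulr_sumr.
by rewrite -mulr_suml.
Qed.

Lemma sum4_delta13 (C : comPzRingType) (I : finType) (F : I -> I -> I -> I -> C) :
  \sum_(p : I * I * I * I) F p.1.1.1 p.1.1.2 p.1.2 p.2 *
      ((p.1.1.1 == p.1.2)%:R * (p.1.1.2 == p.2)%:R)
    = \sum_a \sum_b F a b a b.
Proof.
rewrite -(pair_bigA _ (fun r e => F r.1.1 r.1.2 r.2 e *
   ((r.1.1 == r.2)%:R * (r.1.2 == e)%:R))) /=.
rewrite -(pair_bigA _ (fun r c => \sum_e F r.1 r.2 c e *
   ((r.1 == c)%:R * (r.2 == e)%:R))) /=.
rewrite -(pair_bigA _ (fun a b => \sum_c \sum_e F a b c e *
   ((a == c)%:R * (b == e)%:R))) /=.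
apply: eq_bigr => a _; apply: eq_bigr => b _.
rewrite -[RHS](sum_deltar (fun c => F a b c b)); apply: eq_bigr => c _.
rewrite -(sum_deltar (F a b c)) mulr_suml; apply: eq_bigr => e _.
by ring.
Qed.

Lemma sum4_delta12 (C : comPzRingType) (I : finType) (F : I -> I -> I -> I -> C) :
  \sum_(p : I * I * I * I) F p.1.1.1 p.1.1.2 p.1.2 p.2 *
      ((p.1.1.1 == p.1.1.2)%:R * (p.1.2 == p.2)%:R)
    = \sum_a \sum_c F a a c c.
Proof.
rewrite -(sum4_delta13 (fun a c b e => F a b c e)).
have inv : involutive (fun p : I * I * I * I => (p.1.1.1, p.1.2, p.1.1.2, p.2)).
  by move=> [[[a b] c] e].
rewrite (reindex_inj (inv_inj inv)) /=.
by apply: eq_bigr.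
Qed.

(* The two sides, as tensors G and D in a, b, c, e, satisfy
   <G|G> = <G|D> = <D|D> = 2 #|V|, so |G - D|^2 = 0. *)
Lemma projective_design (C : numClosedFieldType) (I V : finType)
    (v : V -> ket C I) :
    (forall k, unit_ket (v k)) -> #|V| = (#|I| * #|I|.+1)%N ->
    \sum_k \sum_l `|braket (v k) (v l)| ^+ 4 = (2 * #|V|)%:R ->
  forall a b c e, \sum_k v k a * (v k b)^* * (v k c)^* * v k e =
     (a == c)%:R * (b == e)%:R + (a == b)%:R * (c == e)%:R.
Proof.
move=> v1 cV frame a b c e.
pose G (p : I * I * I * I) :=
  \sum_k v k p.1.1.1 * (v k p.1.1.2)^* * (v k p.1.2)^* * v k p.2.
pose D (p : I * I * I * I) : C :=
  (p.1.1.1 == p.1.2)%:R * (p.1.1.2 == p.2)%:R +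
  (p.1.1.1 == p.1.1.2)%:R * (p.1.2 == p.2)%:R.
have v1' k : \sum_x v k x * (v k x)^* = 1.
  by rewrite -(v1 k); apply: eq_bigr => x _; rewrite mulrC.
have v1'' k : \sum_x (v k x)^* * v k x = 1 by exact: v1.
(* The sum over the four indices factors for each pair [k], [l], so [<G|G>] is the frame potential
   bounded by hypothesis. *)
have GG : \sum_p G p * (G p)^* = (2 * #|V|)%:R.
  rewrite -frame /G.
  under eq_bigr => p _ do rewrite rmorph_sum mulr_suml.
  rewrite exchange_big; apply: eq_bigr => k _ /=.
  under eq_bigr => p _ do rewrite mulr_sumr.
  rewrite exchange_big; apply: eq_bigr => l _ /=.
  rewrite (_ : 4%N = (2 * 2)%N) // exprM normCK -braketC expr2.
  have E1 : braket (v l) (v k) = \sum_x v k x * (v l x)^*.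
    by apply: eq_bigr => x _; rewrite mulrC.
  have E2 : braket (v k) (v l) = \sum_x (v k x)^* * v l x by [].
  transitivity (\sum_(p : I * I * I * I) (v k p.1.1.1 * (v l p.1.1.1)^*) *
     ((v k p.1.1.2)^* * v l p.1.1.2) * ((v k p.1.2)^* * v l p.1.2) *
     (v k p.2 * (v l p.2)^*)).
    by apply: eq_bigr => p _; rewrite !rmorphM /= !conjCK; ring.
  rewrite (sum4_prod (fun x => v k x * (v l x)^*) (fun x => (v k x)^* * v l x)
    (fun x => (v k x)^* * v l x)(fun x => v k x * (v l x)^*)) -E1 -E2.
  ring.
(* Each [k] contributes 2: either pairing of the indices in [D] contracts to the squared norm of
   [v k], squared. *)
have GD : \sum_p G p * D p = (2 * #|V|)%:R.
  rewrite /G.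
  under eq_bigr => p _ do rewrite mulr_suml.
  rewrite exchange_big mul2n -addnn natrD -sumr_const -big_split.
  apply: eq_bigr => k _ /=.
  under eq_bigr => p _ do rewrite mulrDr.
  rewrite big_split /=; congr (_ + _).
    rewrite (sum4_delta13 (fun a b c e => v k a * (v k b)^* * (v k c)^* * v k e)).
    transitivity (\sum_x \sum_y (v k x * (v k x)^*) * ((v k y)^* * v k y)).
      by apply: eq_bigr => x _; apply: eq_bigr => y _; ring.
    by under eq_bigr => x _ do rewrite -mulr_sumr v1'' mulr1; rewrite v1'.
  rewrite (sum4_delta12 (fun a b c e => v k a * (v k b)^* * (v k c)^* * v k e)).
  under eq_bigr => x _ do under eq_bigr => y _ do rewrite -mulrA.
  by under eq_bigr => x _ do rewrite -mulr_sumr v1'' mulr1; rewrite v1'.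
have DC p : (D p)^* = D p by rewrite /D rmorphD !rmorphM /= !conjC_nat.
(* Each of the two terms of [D] has squared norm [#|I| ^ 2], and their overlap is [#|I|]. *)
have DD : \sum_p D p * D p = (2 * #|V|)%:R.
  have EV : (2 * #|V|)%:R = (#|I|%:R * #|I|%:R + #|I|%:R) *+ 2 :> C.
    by rewrite cV mulnS natrM natrD natrM; ring.
  have s1 : \sum_(x : I) (1 : C) = #|I|%:R by rewrite sumr_const.
  have s2 : \sum_(x : I) \sum_(y : I) (x == y)%:R * (x == y)%:R = #|I|%:R :> C.
    rewrite -s1; apply: eq_bigr => x _.
    by rewrite (sum_deltar (fun y => (x == y)%:R)) eqxx.
  under [LHS]eq_bigr => p _ do rewrite {2}/D mulrDr.
  rewrite big_split /= EV mulr2n; congr (_ + _).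
    rewrite (sum4_delta13 (fun a b c e => (a == c)%:R * (b == e)%:R +
      (a == b)%:R * (c == e)%:R)).
    under eq_bigr => x _ do under eq_bigr => y _ do rewrite !eqxx mulr1.
    under eq_bigr => x _ do rewrite big_split /= s1.
    by rewrite big_split /= s2 sumr_const -[X in X + _ = _]mulr_natr.
  rewrite (sum4_delta12 (fun a b c e => (a == c)%:R * (b == e)%:R +
      (a == b)%:R * (c == e)%:R)).
  under eq_bigr => x _ do under eq_bigr => y _ do rewrite !eqxx mulr1.
  under eq_bigr => x _ do rewrite big_split /= s1.
  by rewrite big_split /= s2 sumr_const -[X in _ + X = _]mulr_natr addrC.
have sq0 : \sum_p `|G p - D p| ^+ 2 = 0.
  transitivity (\sum_p (G p * (G p)^* - G p * D p - (G p * D p)^* + D p * D p)).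
    apply: eq_bigr => p _; rewrite normCK rmorphB rmorphM /= DC; ring.
  rewrite !big_split /= !sumrN -rmorph_sum /= GG GD DD conjC_nat; ring.
have := psumr_eq0P (fun p _ => exprn_ge0 2 (normr_ge0 (G p - D p))) sq0.
move=> /(_ (a, b, c, e) isT) /eqP; rewrite expf_eq0 normr_eq0 subr_eq0 /=.
by move=> /eqP.
Qed.

(** Contracting the design identity with [X] in the indices [c], [e] turns its two delta terms into
    [X] and the trace of [X] times the identity. *)
Lemma projective_design_sum (C : numClosedFieldType) (I V : finType)
    (v : V -> ket C I) :
    (forall k, unit_ket (v k)) -> #|V| = (#|I| * #|I|.+1)%N ->
    \sum_k \sum_l `|braket (v k) (v l)| ^+ 4 = (2 * #|V|)%:R ->
  forall (X : I -> I -> C) a b,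
    \sum_k (\sum_c \sum_e (v k c)^* * X c e * v k e) * ketbra (v k) a b =
     X a b + (a == b)%:R * \sum_c X c c.
Proof.
move=> v1 cV frame X a b.
have E := projective_design v1 cV frame.
transitivity (\sum_k \sum_c \sum_e
    X c e * (v k a * (v k b)^* * (v k c)^* * v k e)).
  apply: eq_bigr => k _; rewrite mulr_suml; apply: eq_bigr => c _.
  by rewrite mulr_suml; apply: eq_bigr => e _; rewrite /ketbra; ring.
rewrite exchange_big /=.
under eq_bigr => c _ do rewrite exchange_big /=.
under eq_bigr => c _ do under eq_bigr => e _ do rewrite -mulr_sumr E mulrDr.
under eq_bigr => c _ do rewrite big_split /=.
rewrite big_split /=; congr (_ + _).
  rewrite -[RHS](sum_deltar (fun c => X c b)); apply: eq_bigr => c _.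
  by rewrite -(sum_deltar (X c)) mulr_suml; apply: eq_bigr => e _; ring.
rewrite mulr_sumr; apply: eq_bigr => c _.
rewrite -(sum_deltar (X c)) mulr_sumr; apply: eq_bigr => e _; ring.
Qed.

(** * Tight frames and bipartite product bases *)

(** This is the quadratic form of the frame operator at [u]; for [m = 1] it is Parseval's
    identity. *)
Lemma tight_frame_sum (C : numClosedFieldType) (I J : finType)
    (b : J -> ket C I) (m : C) :
    (forall x y, \sum_j ketbra (b j) x y = m * (x == y)%:R) ->
  forall u, \sum_j `|braket (b j) u| ^+ 2 = m * braket u u.
Proof.
move=> frame u.
transitivity (\sum_j \sum_x \sum_y ((u x)^* * u y) * ketbra (b j) x y).
  apply: eq_bigr => j _; rewrite normCK -braketC mulr_suml.
  rewrite exchange_big; apply: eq_bigr => y _ /=.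
  by rewrite mulr_sumr; apply: eq_bigr => x _; rewrite /ketbra; ring.
rewrite exchange_big mulr_sumr; apply: eq_bigr => x _ /=.
rewrite exchange_big /=.
under eq_bigr => y _ do rewrite -mulr_sumr frame mulrCA.
rewrite -mulr_sumr; congr (m * _).
exact: (sum_deltar (fun y => (u x)^* * u y)).
Qed.

Definition prodket (C : numClosedFieldType) (A K : finType)
    (u : ket C A) (w : ket C K) : ket C (A * K)%type :=
  [ffun p => u p.1 * w p.2].

Lemma braket_prodket (C : numClosedFieldType) (A K : finType)
    (u u' : ket C A) (w w' : ket C K) :
  braket (prodket u w) (prodket u' w') = braket u u' * braket w w'.
Proof.
rewrite {1}/braket.
under eq_bigr => p _ do rewrite !ffunE rmorphM /= mulrACA.
rewrite -(pair_bigA _ (fun a k => (u a)^* * u' a * ((w k)^* * w' k))) /=.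
rewrite /braket mulr_suml.
by apply: eq_bigr => a _; rewrite mulr_sumr.
Qed.

(** Tracing the completeness relation over [K] removes the unit vectors [alpha j] and leaves [#|K|]
    times the identity of the first factor. Thus the [phi j] form a tight frame although they need
    not form a basis. *)
Lemma prodket_frame_fst (C : numClosedFieldType) (A K J : finType)
    (phi : J -> ket C A) (alpha : J -> ket C K) :
    orthonormal_basis (fun j => prodket (phi j) (alpha j)) ->
    (forall j, unit_ket (alpha j)) ->
  forall u, \sum_j `|braket (phi j) u| ^+ 2 = #|K|%:R * braket u u.
Proof.
move=> /orthonormal_basis_complete cpl alpha1; apply: tight_frame_sum => x y.
transitivity (\sum_(k : K) (x == y)%:R : C); last first.
  by rewrite sumr_const mulr_natl.
under [RHS]eq_bigr => k _.
  rewrite (_ : x == y = ((x, k) == (y, k))); last by rewrite xpair_eqE eqxx andbT.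
  rewrite -cpl; over.
rewrite exchange_big; apply: eq_bigr => j _ /=.
rewrite -[LHS]mulr1 -(alpha1 j) mulr_sumr; apply: eq_bigr => k _.
by rewrite !ffunE /ketbra /= rmorphM /=; ring.
Qed.

Lemma prodket_frame_snd (C : numClosedFieldType) (A K J : finType)
    (phi : J -> ket C A) (alpha : J -> ket C K) :
    orthonormal_basis (fun j => prodket (phi j) (alpha j)) ->
    (forall j, unit_ket (phi j)) ->
  forall u, \sum_j `|braket (alpha j) u| ^+ 2 = #|A|%:R * braket u u.
Proof.
move=> /orthonormal_basis_complete cpl phi1; apply: tight_frame_sum => x y.
transitivity (\sum_(a : A) (x == y)%:R : C); last first.
  by rewrite sumr_const mulr_natl.
under [RHS]eq_bigr => a _.
  rewrite (_ : x == y = ((a, x) == (a, y))); last by rewrite xpair_eqE eqxx.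
  rewrite -cpl; over.
rewrite exchange_big; apply: eq_bigr => j _ /=.
rewrite -[LHS]mulr1 -(phi1 j) mulr_sumr; apply: eq_bigr => a _.
by rewrite !ffunE /ketbra /= rmorphM /=; ring.
Qed.

Lemma factor_unbiased (C : numClosedFieldType) (A K J : finType)
    (phi : J -> ket C A) (alpha : J -> ket C K) (u : ket C A) (w : ket C K) :
    orthonormal_basis (fun j => prodket (phi j) (alpha j)) ->
    (forall j, unit_ket (phi j)) -> (forall j, unit_ket (alpha j)) ->
    unit_ket u -> unit_ket w ->
    (forall j, `|braket (prodket (phi j) (alpha j)) (prodket u w)| ^+ 2
       = #|{: A * K}|%:R^-1) ->
  forall j, `|braket (phi j) u| ^+ 2 = #|A|%:R^-1.
Proof.
move=> ob phi1 alpha1 u1 w1 unb j0.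
pose x j := `|braket (phi j) u| ^+ 2; pose y j := `|braket (alpha j) w| ^+ 2.
set n : C := #|A|%:R; set m : C := #|K|%:R.
have Sx : \sum_j x j = m by rewrite (prodket_frame_fst ob) // u1 mulr1.
have Sy : \sum_j y j = n by rewrite (prodket_frame_snd ob) // w1 mulr1.
have cJ : #|J| = (#|A| * #|K|)%N by rewrite (orthonormal_basis_card ob) card_prod.
have nm0 : n * m != 0.
  (* The index [j0] excludes the case of an empty [J]. *)
  by rewrite -natrM -cJ pnatr_eq0 -lt0n; apply/card_gt0P; exists j0.
have xy j : n * x j * (m * y j) = 1.
  have := unb j; rewrite braket_prodket normrM exprMn card_prod natrM => E.
  by rewrite mulrACA E mulfV.
have x0 j : 0 <= n * x j by rewrite mulr_ge0 ?ler0n ?exprn_ge0.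
have y0 j : 0 <= m * y j by rewrite mulr_ge0 ?ler0n ?exprn_ge0.
(* AM-GM: [s + t - 2 = s (1 - t)^2] when [s t = 1]. *)
have t0 j : 0 <= n * x j * (1 - m * y j) ^+ 2.
  by rewrite mulr_ge0 // real_exprn_even_ge0 // rpredB ?rpred1 // ger0_real.
have S0 : \sum_j n * x j * (1 - m * y j) ^+ 2 = 0.
  transitivity (\sum_j (n * x j + m * y j - 2)).
    apply: eq_bigr => j _.
    have -> : n * x j * (1 - m * y j) ^+ 2 =
      n * x j - (n * x j * (m * y j)) * 2 + (n * x j * (m * y j)) * (m * y j).
      by ring.
    by rewrite xy; ring.
  (* The three parts sum to [n * m], [m * n] and [- 2 * n * m], since there are [n * m] basis
     vectors. *)
  rewrite !big_split /= -!mulr_sumr Sx Sy sumr_const -[_ *+ _]mulr_natr.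
  by rewrite (_ : #|_| = #|J|) // cJ natrM; ring.
have := psumr_eq0P (fun j _ => t0 j) S0 => /(_ j0 isT) /eqP.
have nx0 : n * x j0 != 0.
  by apply: contra_eq_neq (xy j0) => ->; rewrite mul0r eq_sym oner_eq0.
rewrite mulf_eq0 (negPf nx0) expf_eq0 /= subr_eq0 => /eqP my1.
have := xy j0; rewrite -my1 mulr1 => nx1.
have n0 : n != 0 by apply: contraNneq nm0 => ->; rewrite mul0r.
by apply: (mulfI n0); rewrite nx1 mulfV.
Qed.

(** * Complete sets of mutually unbiased bases *)

(** With as many vectors as dimensions, the matrix of the vectors is square, so its one-sided
    inverse is two-sided. *)
Lemma orthonormal_complete (C : numClosedFieldType) (n : nat)
    (v : 'I_n -> ket C 'I_n) :
    (forall i j, braket (v i) (v j) = (i == j)%:R) ->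
  forall a b, \sum_i ketbra (v i) a b = (a == b)%:R.
Proof.
move=> orth a b.
pose M := \matrix_(i, x) (v i x)^*; pose N := \matrix_(x, i) v i x.
have MN : M *m N = 1%:M.
  apply/matrixP => i j; rewrite !mxE -orth.
  by apply: eq_bigr => x _; rewrite !mxE.
have /matrixP/(_ a b) := mulmx1C MN; rewrite !mxE => <-.
by apply: eq_bigr => i _; rewrite !mxE.
Qed.

(** The frame potential has the design value: against a fixed vector, its own basis contributes 1
    and each of the [n] others contributes [n] terms equal to [1/n^2], which makes 2 per vector. *)
Lemma mub_design_sum (C : numClosedFieldType) (n : nat) (S : finType)
    (v : S -> 'I_n -> ket C 'I_n) :
    #|S| = n.+1 ->
    (forall s i j, braket (v s i) (v s j) = (i == j)%:R) ->
    (forall s t, s != t -> unbiased_bases (v s) (v t)) ->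
  forall (X : 'I_n -> 'I_n -> C) a b,
    \sum_s \sum_i (\sum_c \sum_e (v s i c)^* * X c e * v s i e) *
      ketbra (v s i) a b = X a b + (a == b)%:R * \sum_c X c c.
Proof.
move=> cS orth unb X a b.
rewrite (pair_bigA _ (fun s i => (\sum_c \sum_e (v s i c)^* * X c e * v s i e) *
      ketbra (v s i) a b)) /=.
apply: (projective_design_sum (v := fun p : S * 'I_n => v p.1 p.2)).
- by move=> p; rewrite /unit_ket orth eqxx.
- by rewrite card_prod cS card_ord mulnC.
rewrite mulnC natrM mulr_natl -sumr_const; apply: eq_bigr => -[s i] _.
rewrite -(pair_bigA _ (fun t j => `|braket (v s i) (v t j)| ^+ 4)) /=.
rewrite (bigD1 s) //=.
have -> : \sum_j `|braket (v s i) (v s j)| ^+ 4 = 1 :> C.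
  under eq_bigr => j _ do rewrite orth normr_nat -natrX -[_%:R]mul1r.
  rewrite (eq_bigr (fun j => 1 * (i == j)%:R)) ?(sum_deltar (fun=> 1)) //.
  by move=> j _; case: (i == j).
have n0 : n%:R != 0 :> C by rewrite pnatr_eq0; case: (n) i => [[]|].
rewrite (eq_bigr (fun=> n%:R^-1)).
  by rewrite sumr_const cardC1 cS -[X in _ + X = _]mulr_natr mulVf.
move=> t; rewrite eq_sym => st.
under eq_bigr => j _ do rewrite (exprM _ 2 2) unb // card_ord.
by rewrite sumr_const card_ord -[LHS]mulr_natr expr2 -mulrA mulVf ?mulr1.
Qed.

Lemma ketbra_form (C : numClosedFieldType) (I : finType) (u w : ket C I) :
  \sum_c \sum_e (w c)^* * ketbra u c e * w e = `|braket w u| ^+ 2.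
Proof.
rewrite normCK -braketC mulr_suml; apply: eq_bigr => c _.
by rewrite mulr_sumr; apply: eq_bigr => e _; rewrite /ketbra; ring.
Qed.

(** For [X = |u><u|], the [n] bases other than [s] contribute the identity in total, which cancels
    the trace term. Hence [|u><u|] is diagonal in the basis [v s], and having rank one it forces [u]
    to be orthogonal or proportional to each [v s i]. *)
Lemma mub_last_basis (C : numClosedFieldType) (n : nat) (S : finType)
    (v : S -> 'I_n -> ket C 'I_n) (s : S) (u : ket C 'I_n) :
    #|S| = n.+1 ->
    (forall s i j, braket (v s i) (v s j) = (i == j)%:R) ->
    (forall s t, s != t -> unbiased_bases (v s) (v t)) ->
    unit_ket u -> (forall t, t != s -> unbiased_to_basis u (v t)) ->
  forall i, braket (v s i) u = 0 \/ forall a, u a = braket (v s i) u * v s i a.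
Proof.
move=> cS orth unb u1 uunb i.
have n0 : n%:R != 0 :> C by rewrite pnatr_eq0; case: (n) i => [[]|].
have dec a b : ketbra u a b =
    \sum_j `|braket (v s j) u| ^+ 2 * ketbra (v s j) a b.
  have := mub_design_sum cS orth unb (ketbra u) a b.
  rewrite [\sum_c ketbra u c c](_ : _ = 1); last first.
    by rewrite -u1; apply: eq_bigr => x _; rewrite mulrC.
  rewrite (bigD1 s) //= mulr1.
  under eq_bigr => j _ do rewrite ketbra_form.
  rewrite [X in _ + X](_ : _ = (a == b)%:R); first by move=> /addIr.
  rewrite (eq_bigr (fun=> n%:R^-1 * (a == b)%:R)).
    by rewrite sumr_const cardC1 cS -[_ *+ _]mulr_natl mulVKf.
  move=> t ts; rewrite -(orthonormal_complete (orth t)) mulr_sumr.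
  by apply: eq_bigr => j _; rewrite ketbra_form uunb // card_ord.
have [->|c0] := eqVneq (braket (v s i) u) 0; [by left | right=> a].
have c0' : (braket (v s i) u)^* != 0 by rewrite conjC_eq0.
apply: (mulIf c0').
(* The operator [|u><u|] is applied to [v s i], once directly and once through [dec]. *)
transitivity (\sum_b ketbra u a b * v s i b).
  by rewrite -braketC mulr_sumr; apply: eq_bigr => b _; rewrite /ketbra mulrA.
under eq_bigr => b _ do rewrite dec mulr_suml.
rewrite exchange_big /=.
transitivity (\sum_j (`|braket (v s j) u| ^+ 2 * v s j a) * (i == j)%:R).
  apply: eq_bigr => j _; rewrite eq_sym -(orth s) mulr_sumr.
  by apply: eq_bigr => b _; rewrite /ketbra; ring.
by rewrite (sum_deltar (fun j => `|braket (v s j) u| ^+ 2 * v s j a)) normCK mulrAC.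
Qed.

(** * The reduced state across a bipartite cut *)

Lemma product_mubs_reduced_state (C : numClosedFieldType) (n : nat)
    (K J S : finType) (phi : S -> J -> ket C 'I_n) (alpha : S -> J -> ket C K)
    (f : S -> 'I_n -> J) (mu : ket C ('I_n * K)%type) :
    #|S| = n.+1 ->
    (forall s j, unit_ket (phi s j)) -> (forall s j, unit_ket (alpha s j)) ->
    (forall s, orthonormal_basis (fun j => prodket (phi s j) (alpha s j))) ->
    (forall s t, s != t -> unbiased_bases
       (fun j => prodket (phi s j) (alpha s j))
       (fun j => prodket (phi t j) (alpha t j))) ->
    (forall s i j, i != j -> braket (phi s (f s i)) (phi s (f s j)) = 0) ->
    unit_ket mu ->
    (forall s, unbiased_to_basis mu (fun j => prodket (phi s j) (alpha s j))) ->
  forall a b, \sum_k mu (a, k) * (mu (b, k))^* = n%:R^-1 * (a == b)%:R.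
Proof.
move=> cS phi1 alpha1 ob unb orthf mu1 muunb a b.
pose v s i := phi s (f s i).
have orth s i j : braket (v s i) (v s j) = (i == j)%:R.
  have [->|ij] := eqVneq i j; [exact: phi1 | exact: orthf].
(* This covers all first factors and not only those selected by [f], so that every [phi s j] can be
   compared with the basis [v s]. *)
have unbphi s t : s != t -> forall i j,
    `|braket (phi s i) (phi t j)| ^+ 2 = #|'I_n|%:R^-1.
  move=> st i j; apply: (factor_unbiased (w := alpha t j) (ob s)) => // k.
  exact: (unb _ _ st k j).
have unbv s t : s != t -> unbiased_bases (v s) (v t).
  by move=> st i j; apply: unbphi.
have n0 : n%:R != 0 :> C by rewrite pnatr_eq0; case: (n) a => [[]|].
(* [X] is the reduced density matrix of [mu] on the first factor. *)
pose X c e := \sum_k mu (c, k) * (mu (e, k))^*.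
have trX : \sum_c X c c = 1.
  rewrite -mu1 /X (pair_bigA _ (fun c k => mu (c, k) * (mu (c, k))^*)) /=.
  by apply: eq_bigr => -[c k] _; rewrite mulrC.
have vXv s i : \sum_c \sum_e (v s i c)^* * X c e * v s i e = n%:R^-1.
  (* [w] is the partial inner product of [v s i] with [mu], so [prodket (v s i) w] is the image of
     [mu] under [|v><v|] tensored with the identity, and its squared norm is [<v|X|v>]. *)
  pose w : ket C K := [ffun k => \sum_c (v s i c)^* * mu (c, k)].
  transitivity (braket (prodket (v s i) w) (prodket (v s i) w)).
    rewrite braket_prodket phi1 mul1r /X.
    transitivity (\sum_k \sum_c \sum_e
        (v s i c)^* * (mu (c, k) * (mu (e, k))^*) * v s i e).
      rewrite [RHS]exchange_big; apply: eq_bigr => c _ /=.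
      rewrite [RHS]exchange_big; apply: eq_bigr => e _ /=.
      by rewrite mulr_sumr mulr_suml.
    apply: eq_bigr => k _; rewrite ffunE rmorph_sum mulrC mulr_suml.
    apply: eq_bigr => c _; rewrite mulr_sumr; apply: eq_bigr => e _.
    by rewrite rmorphM /= conjCK; ring.
  have frame1 x y :
      \sum_j ketbra (prodket (phi s j) (alpha s j)) x y = 1 * (x == y)%:R.
    by rewrite mul1r -(orthonormal_basis_complete (ob s)).
  rewrite -[LHS]mul1r -(tight_frame_sum frame1).
  (* If [phi s j] is orthogonal to [v s i], both terms vanish. Otherwise they differ by a phase, and
     the projection does not change the overlap of the [j]-th basis vector with [mu]. *)
  transitivity (\sum_j `|braket (phi s j) (v s i)| ^+ 2 * (n%:R * #|K|%:R)^-1).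
    apply: eq_bigr => j _.
    have [E|E] := mub_last_basis cS orth unbv (phi1 s j)
      (fun t ts i' => unbphi _ _ ts _ j) i.
      by rewrite braket_prodket braketC E conjC0 mul0r normr0 expr0n mul0r.
    set c := braket (v s i) (phi s j) in E.
    have c1 : `|c| ^+ 2 = 1.
      rewrite -(phi1 s j) normCK -[c * _]mulr1 -(phi1 s (f s i)) mulr_sumr.
      by apply: eq_bigr => x _; rewrite E rmorphM /= -/(v s i); ring.
    rewrite (braketC (v s i)) -/c norm_conjC c1 mul1r.
    rewrite -[n in n%:R]card_ord -natrM -card_prod -(muunb s j).
    congr (`|_| ^+ 2); rewrite braket_prodket (braketC (v s i)) -/c.
    transitivity (\sum_a \sum_k (phi s j a * alpha s j k)^* * mu (a, k)).
      rewrite exchange_big mulr_sumr; apply: eq_bigr => k _ /=.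
      rewrite ffunE !mulr_sumr; apply: eq_bigr => a' _.
      by rewrite E !rmorphM /=; ring.
    rewrite (pair_bigA _ (fun a k => (phi s j a * alpha s j k)^* * mu (a, k))) /=.
    by apply: eq_bigr => -[a' k] _; rewrite ffunE.
  rewrite -mulr_suml (prodket_frame_fst (ob s)) // phi1 mulr1 invfM mulrCA mulfV.
    by rewrite mulr1.
  (* An empty [K] would carry no unit vector [alpha]. *)
  rewrite pnatr_eq0; apply/eqP => /card0_eq K0.
  have := alpha1 s (f s i); rewrite /unit_ket /braket big_pred0.
    by move=> /eqP; rewrite eq_sym oner_eq0.
  by move=> k; have := K0 k.
(* Each of the [n.+1] bases contributes [1/n] times the identity, while the trace term is the
   identity; the difference is [X]. *)
have := mub_design_sum cS orth unbv X a b.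
rewrite trX mulr1.
under eq_bigr => s _.
  under eq_bigr => i _ do rewrite vXv.
  rewrite -mulr_sumr orthonormal_complete //.
  over.
rewrite sumr_const cS -[_ *+ _]mulr_natl mulrA -natr1 mulrDl mulfV // mul1r.
by rewrite mulrDl mul1r addrC => /addIr ->.
Qed.

(** * Normalized factors and the cut between one factor and the rest *)

(** The norms of the two factors are inverse to each other, so [c] is the inverse norm of [u]. *)
Lemma prodket_normalize (C : numClosedFieldType) (A K : finType)
    (u : ket C A) (w : ket C K) : unit_ket (prodket u w) ->
  exists c : C, [/\ unit_ket (C := C) [ffun a => c * u a],
    unit_ket (C := C) [ffun k => c^-1 * w k] &
    prodket u w = prodket (C := C) [ffun a => c * u a] [ffun k => c^-1 * w k]].
Proof.
rewrite /unit_ket braket_prodket => uw1.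
have u_neq0 : braket u u != 0.
  by apply: contra_eq_neq uw1 => ->; rewrite mul0r eq_sym oner_eq0.
have u_ge0 : 0 <= braket u u.
  by apply: sumr_ge0 => a _; rewrite mulrC mul_conjC_ge0.
pose q := sqrtC (braket u u).
have q0 : q != 0 by rewrite sqrtC_eq0.
have qC : q^* = q by apply: CrealP; rewrite ger0_real // sqrtC_ge0.
have qq : q * q = braket u u by rewrite -expr2 sqrtCK.
exists q^-1; split.
- apply: (mulfI u_neq0); rewrite mulr1 -[in LHS]qq /braket mulr_sumr.
  by apply: eq_bigr => a _; rewrite ffunE rmorphM fmorphV /= qC; field.
- rewrite -uw1 -qq /braket mulr_sumr; apply: eq_bigr => k _.
  by rewrite ffunE invrK rmorphM /= qC; ring.
by apply/ffunP => -[a k]; rewrite !ffunE /=; field.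
Qed.

Section Cut.
Variables (n : nat) (d : 'I_n.+1 -> nat) (r : 'I_n.+1) (z : 'I_(d r)).

(* The indices of the factors other than [r], as multi-indices whose [r]-th
   component is frozen to [z]. *)
Definition cofactor_index : finType := {x : multi_index d | x r == z}.

Definition glue (p : 'I_(d r) * cofactor_index) : multi_index d :=
  finfun (dfwith (fun s => val p.2 s) p.1).

Lemma glue_in p : glue p r = p.1.
Proof. by rewrite ffunE dfwith_in. Qed.

Lemma glue_out p s : s != r -> glue p s = val p.2 s.
Proof. by move=> sr; rewrite ffunE dfwith_out // eq_sym. Qed.

(** The inverse reads off the [r]-th component and then freezes it to [z]. *)
Lemma glue_bij : bijective glue.
Proof.
have frozen (x : multi_index d) :
    (finfun (dfwith (fun s => x s) z) : multi_index d) r == z.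
  by rewrite ffunE dfwith_in.
exists (fun x : multi_index d =>
  (x r, exist (fun y : multi_index d => y r == z) _ (frozen x) : cofactor_index)).
  move=> [a k]; rewrite glue_in; congr (_, _); apply: val_inj => /=.
  apply/ffunP => s; rewrite ffunE; have [->|sr] := eqVneq s r.
    by rewrite dfwith_in (eqP (valP k)).
  by rewrite dfwith_out 1?eq_sym // glue_out.
move=> x; apply/ffunP => s; have [->|sr] := eqVneq s r; first by rewrite glue_in.
by rewrite glue_out //= ffunE dfwith_out // eq_sym.
Qed.

Variable C : numClosedFieldType.

Definition cut_ket (u : ket C (multi_index d)) :
    ket C ('I_(d r) * cofactor_index)%type := [ffun p => u (glue p)].

Lemma braket_cut u v : braket (cut_ket u) (cut_ket v) = braket u v.
Proof.
rewrite /braket [RHS](reindex glue) /=; last exact: onW_bij glue_bij.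
by apply: eq_bigr => p _; rewrite !ffunE.
Qed.

Lemma card_cut : #|{: 'I_(d r) * cofactor_index}| = #|multi_index d|.
Proof. exact: bij_eq_card glue_bij. Qed.

Lemma orthonormal_basis_cut (J : finType) (b : J -> ket C (multi_index d)) :
  orthonormal_basis b -> orthonormal_basis (fun j => cut_ket (b j)).
Proof.
move=> [orth span]; split=> [i j|v]; first by rewrite braket_cut.
have [h hK _] := glue_bij.
have [c Ec] := span [ffun x => v (h x)]; exists c => p.
rewrite -[in LHS](hK p); have := Ec (glue p); rewrite ffunE => ->.
by apply: eq_bigr => j _; rewrite ffunE.
Qed.

Lemma tensor_cut (psi : forall s, ket C 'I_(d s)) :
  cut_ket (tensor psi) =
  prodket (psi r) [ffun k : cofactor_index => \prod_(s | s != r) psi s (val k s)].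
Proof.
apply/ffunP => p; rewrite !ffunE (bigD1 r) //= glue_in; congr (_ * _).
by apply: eq_bigr => s sr; rewrite glue_out.
Qed.

Lemma partial_trace_cut (u : ket C (multi_index d)) a b :
  partial_trace_but r (ketbra u) a b =
  \sum_k cut_ket u (a, k) * (cut_ket u (b, k))^*.
Proof.
rewrite mxE (reindex glue) /=; last exact: onW_bij glue_bij.
under eq_bigl => p do rewrite glue_in.
transitivity (\sum_(p : 'I_(d r) * cofactor_index | p.1 == a)
    cut_ket u p * (cut_ket u (b, p.2))^*).
  apply: eq_bigr => p _; rewrite !ffunE (big_pred1 (glue (b, p.2))) // => y.
  apply/andP/eqP => [[/eqP yb /forallP yp] | ->].
    apply/ffunP => s; have [->|sr] := eqVneq s r; first by rewrite glue_in.
    by have := yp s; rewrite sr !glue_out //= => /eqP.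
  rewrite glue_in; split=> //; apply/forallP => s; apply/implyP => sr.
  by rewrite !glue_out.
transitivity (\sum_(a' | a' == a) \sum_k cut_ket u (a', k) * (cut_ket u (b, k))^*).
  by rewrite pair_big /=; apply: eq_big => [p|[a' k] _] //; rewrite andbT.
by rewrite big_pred1_eq.
Qed.

(** The given factors are only determined up to scalars; rescaling them to unit vectors keeps the
    selected ones orthogonal. *)
Lemma normalized_orthogonal_factors (J : finType) (b : J -> ket C (multi_index d)) :
    (forall j, unit_ket (b j)) -> has_orthogonal_factors r b ->
  exists (phi : J -> ket C 'I_(d r)) (alpha : J -> ket C cofactor_index)
      (f : 'I_(d r) -> J),
    [/\ forall j, unit_ket (phi j), forall j, unit_ket (alpha j),
      forall j, cut_ket (b j) = prodket (phi j) (alpha j) &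
      forall i j, i != j -> braket (phi (f i)) (phi (f j)) = 0].
Proof.
move=> b1 [psi [f [bE orthf]]].
pose w j := [ffun k : cofactor_index => \prod_(s | s != r) psi j s (val k s)].
have bcut j : cut_ket (b j) = prodket (psi j r) (w j) by rewrite bE tensor_cut.
have w1 j : unit_ket (prodket (psi j r) (w j)).
  by rewrite /unit_ket -bcut braket_cut b1.
have [c cP] := fin_all_exists (fun j => prodket_normalize (w1 j)).
exists (fun j => [ffun a => c j * psi j r a]).
exists (fun j => [ffun k => (c j)^-1 * w j k]), f.
split=> [j|j|j|i j /orthf E]; try by have [] := cP j.
  by rewrite bcut; have [] := cP j.
rewrite -[RHS](mulr0 ((c (f i))^* * c (f j))) -E /braket mulr_sumr.
by apply: eq_bigr => a _; rewrite !ffunE rmorphM /=; ring.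
Qed.

End Cut.

(** * From the bipartite cut to several factors *)

Lemma product_mubs_maximally_entangled (C : numClosedFieldType) (n : nat)
    (d : 'I_n.+1 -> nat) (r : 'I_n.+1) (J S : finType)
    (B : S -> J -> ket C (multi_index d)) (mu : ket C (multi_index d)) :
    (0 < d r)%N -> #|S| = (d r).+1 ->
    (forall s, orthonormal_basis (B s)) ->
    (forall s t, s != t -> unbiased_bases (B s) (B t)) ->
    (forall s, has_orthogonal_factors r (B s)) ->
    unit_ket mu -> (forall s, unbiased_to_basis mu (B s)) ->
  maximally_entangled r mu.
Proof.
move=> d_gt0 cS ob unb factors mu1 muunb; split=> //.
pose z := Ordinal d_gt0.
have B1 s j : unit_ket (B s j) by have [orth _] := ob s; rewrite /unit_ket orth eqxx.
have [phi /fin_all_exists [alpha /fin_all_exists [f fP]]] := fin_all_exists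
  (fun s => normalized_orthogonal_factors z (B1 s) (factors s)).
have BE s j : cut_ket z (B s j) = prodket (phi s j) (alpha s j).
  by have [] := fP s.
apply/matrixP => a b; rewrite (partial_trace_cut z) mxE -[RHS]mulr_natr.
apply: (product_mubs_reduced_state (phi := phi) (alpha := alpha) (f := f)) => //.
- by move=> s j; have [] := fP s.
- by move=> s j; have [] := fP s.
- move=> s; have [orth span] := orthonormal_basis_cut z (ob s).
  split=> [i j|v]; first by rewrite -!BE.
  have [c Ec] := span v; exists c => x; rewrite Ec.
  by apply: eq_bigr => j _; rewrite BE.
- by move=> s t st i j; rewrite -!BE braket_cut unb // card_cut.
- by move=> s; have [] := fP s.
- by rewrite /unit_ket braket_cut.
- by move=> s i; rewrite -BE braket_cut muunb card_cut.
Qed.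

Theorem lemma5 (R : realType) (n : nat) (p k d : 'I_n.+1 -> nat)
  (p_prime : forall r, prime (p r))
  (k_pos : forall r, (1 <= k r)%N)
  (d_def : forall r, d r = (p r ^ k r)%N)
  (d_sorted : forall r s : 'I_n.+1, (r <= s)%N -> (d r <= d s)%N)
  (B : 'I_(d ord0).+1 -> 'I_(\prod_r d r)%N -> ket R[i] (multi_index d))
  (B_product : forall s, product_basis (B s))
  (B_unbiased : forall s t, s != t -> unbiased_bases (B s) (B t))
  (B_factors : forall s, has_orthogonal_factors ord0 (B s))
  (mu : ket R[i] (multi_index d))
  (mu_unit : unit_ket mu)
  (mu_unbiased : forall s, unbiased_to_basis mu (B s)) :
  maximally_entangled ord0 mu.
Proof.
apply: (product_mubs_maximally_entangled (B := B)) => //.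
- by rewrite d_def expn_gt0 prime_gt0.
- by rewrite card_ord.
- by move=> s; have [] := B_product s.
Qed.
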